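(* Let $x\in[-1,1]$, let $X=\{x\}$ and put $t=\frac{\arccos x}{2\pi}$. If $t$ is rational and $t=p/q$ with $p$ and $q$ coprime integers ($q\geq 1$), then $$\alpha_X(2)=\begin{cases}1/2, & \text{if } q \text{ is even},\\ (q-1)/(2q), & \text{if } q\text{ is odd},\end{cases}$$ and in this case $\alpha_X(2)$ is attained as a maximum, i.e. there is a Lebesgue measurable $X$-avoiding set $I\subset S^1$ with $\lambda(I)=\alpha_X(2)$. If $t$ is irrational, then $\alpha_X(2)=1/2$, but there exists no Lebesgue measurable $X$-avoiding set $I\subset S^1$ with $\lambda(I)=1/2$.
   Context: $S^{1}=\{v\in\mathbb{R}^2:\langle v,v\rangle=1\}$ is the unit circle, with $\langle\cdot,\cdot\rangle$ the standard inner product, and $\lambda$ is the Lebesgue (arc length) measure on $S^1$, normalised so that $\lambda(S^1)=1$. For $X\subset[-1,1]$, a subset $I\subset S^{1}$ is called $X$-avoiding if $\langle\xi,\eta\rangle\notin X$ for all $\xi,\eta\in I$ (including $\xi=\eta$). Define $$\alpha_X(2):=\sup\{\lambda(I): I\subset S^{1}\text{ is Lebesgue measurable and } X\text{-avoiding}\}.$$ *)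

(* Defs.v *)
From HB Require Import structures.
From mathcomp Require Import all_boot all_order all_algebra.
From mathcomp Require Import all_classical all_reals all_analysis.

Set Implicit Arguments.
Unset Strict Implicit.
Unset Printing Implicit Defensive.

Import Order.TTheory GRing.Theory Num.Theory.

Local Open Scope classical_set_scope.
Local Open Scope ring_scope.

Definition inner (R : realType) (n : nat) (u v : 'rV[R]_n) : R :=
  \sum_(i < n) u 0 i * v 0 i.

Definition unit_circle (R : realType) : set 'rV[R]_2 :=
  [set v | inner v v = 1].
Arguments unit_circle R : clear implicits.

(* The domain of [completed_lebesgue_measure]: Lebesgue measurable sets in the
   sense of Caratheodory, and not just the Borel sets on which the library's
   [lebesgue_measure] is a measure. *)
Definition lebesgue_measurable (R : realType) (A : set R) : Prop :=
  ((@wlength R idfun)^*%mu).-cara.-measurable A.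

(* Arc-length parametrisation of the unit circle, bijective on [0, 2 pi[ *)
Definition circle_point (R : realType) (theta : R) : 'rV[R]_2 :=
  \row_(i < 2) (if i == 0 then cos theta else sin theta).

Definition circle_angles (R : realType) (I : set 'rV[R]_2) : set R :=
  `[0, 2 * pi[ `&` (@circle_point R @^-1` I).

Definition circle_measurable (R : realType) (I : set 'rV[R]_2) : Prop :=
  I `<=` unit_circle R /\ lebesgue_measurable (circle_angles I).

Definition circle_measure (R : realType) (I : set 'rV[R]_2) : \bar R :=
  (((2 * pi)^-1)%:E * completed_lebesgue_measure (circle_angles I))%E.

(* The case xi = eta is included. *)
Definition avoiding (R : realType) (X : set R) (I : set 'rV[R]_2) : Prop :=
  I `<=` unit_circle R /\
  forall xi eta, I xi -> I eta -> ~ X (inner xi eta).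

Definition alpha2 (R : realType) (X : set R) : \bar R :=
  ereal_sup [set circle_measure I |
             I in [set I | circle_measurable I /\ avoiding X I]].

(* Main.v *)
(* A subset I of the circle lifts to a 2 pi-periodic set E of angles, and I
   avoids x exactly when E and its translate by theta = acos x are disjoint, so
   I has density at most 1/2.  If q theta is a multiple of 2 pi with q odd, an
   orbit of the rotation cannot alternate between E and its complement, hence q
   rotates of the gap left by E and its translate cover the circle and the gap
   has density at least 1/q.  Conversely the angles u whose multiple N u / 2 pi
   has fractional part less than c form an avoiding set of density c as soon as
   N t is congruent modulo 1 to some s in [c, 1 - c]; N comes from Bezout's
   identity when t is rational and from the density of the multiples of t when
   it is irrational.  Finally, suppose t is irrational and I has density 1/2.
   Then E and its translate by theta partition the line up to a null set, so
   the measure of E in a window of length l, a Lipschitz function of the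
   position of the window, is invariant under 2 theta and 2 pi, hence constant,
   hence l / 2.  Covering E by intervals then shows that its measure over a
   period is at most half of itself. *)

Require Import Defs.
From mathcomp Require Import all_boot all_order all_algebra.
From mathcomp Require Import all_classical all_reals all_analysis.
From mathcomp Require Import ring lra zify.

Import Order.TTheory GRing.Theory Num.Theory.

Local Open Scope classical_set_scope.
Local Open Scope ring_scope.

(* The translate of A by - s. *)
Definition shifted {R : realType} (s : R) (A : set R) : set R :=
  [set u | A (u + s)].

(** * Lebesgue outer measure on the line and translations *)

Section lebesgue_outer_measure.
Context {R : realType}.
Implicit Types (A B E : set R) (a b s L : R).

Local Notation mu := ((@wlength R idfun)^*)%mu.

Lemma shifted_itvoc s a b :
  shifted s `]a, b]%classic = `](a - s), (b - s)]%classic.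
Proof.
by apply/seteqP; split=> u /=; rewrite !in_itv/= ltrBlDr lerBrDr.
Qed.

Lemma shifted_itvco s a b :
  shifted s `[a, b[%classic = `[(a - s), (b - s)[%classic.
Proof.
by apply/seteqP; split=> u /=; rewrite !in_itv/= lerBlDr ltrBrDr.
Qed.

Lemma shiftedD s t A : shifted s (shifted t A) = shifted (s + t) A.
Proof. by apply/seteqP; split=> u /=; rewrite /shifted/= addrA. Qed.

Lemma shifted0 A : shifted 0 A = A.
Proof. by apply/seteqP; split=> u /=; rewrite /shifted/= addr0. Qed.

Lemma shiftedI s A B : shifted s (A `&` B) = shifted s A `&` shifted s B.
Proof. by []. Qed.

Lemma shiftedU s A B : shifted s (A `|` B) = shifted s A `|` shifted s B.
Proof. by []. Qed.

Lemma shiftedC s A : shifted s (~` A) = ~` shifted s A.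
Proof. by []. Qed.

Lemma wlength_shifted s A : ocitv A ->
  wlength idfun (shifted s A) = wlength idfun A.
Proof.
move=> [[a b] _ <-] /=; rewrite shifted_itvoc !wlength_itv/= !lte_fin.
by rewrite ltrD2r -!EFinB; case: ifP => // _; congr EFin; ring.
Qed.

(** Translating a cover by intervals keeps the lengths, which gives one inequality; the other is the
    same one applied to the translation by [- s]. *)
Lemma mu_shifted s A : mu (shifted s A) = mu A.
Proof.
have le_shifted t B : (mu (shifted t B) <= mu B)%E.
  apply: le_ereal_inf_tmp => _ [F [mF BF] <-].
  apply: ereal_inf_lbound; exists (fun k => shifted t (F k)).
    split=> [k|u /BF[k _ Fku]]; last by exists k.
    by have [[x y] _ <-] := mF k; rewrite /= shifted_itvoc; exact: is_ocitv.
  by apply: eq_eseriesr => k _; apply: wlength_shifted; exact: mF.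
apply/eqP; rewrite eq_le le_shifted/=.
by rewrite -[in leLHS](shifted0 A) -(addNr s) -shiftedD le_shifted.
Qed.

Lemma lebesgue_measurableP A :
  lebesgue_measurable A <-> mu.-caratheodory A.
Proof. by []. Qed.

(** Exposes the Caratheodory equation, so that it can be applied to an arbitrary test set. *)
Lemma lebesgue_measurable_shifted s A :
  lebesgue_measurable A -> lebesgue_measurable (shifted s A).
Proof.
(* The test set is moved back by [s], cut along [A], and the two pieces are moved forward again. *)
move=> /lebesgue_measurableP mA; apply/lebesgue_measurableP => X.
 rewrite -(mu_shifted (- s) X) (mA (shifted (- s) X)).
rewrite -(mu_shifted s (_ `&` A)) -(mu_shifted s (_ `&` ~` A)).
have shiftK B : shifted s (shifted (- s) X `&` B) = X `&` shifted s B.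
  by apply/seteqP; split=> u /=; rewrite /shifted/= addrK.
by rewrite !shiftK.
Qed.

Lemma lebesgue_measurable_itv (i : interval R) :
  lebesgue_measurable [set` i].
Proof. by apply: sub_caratheodory; exact: measurable_itv. Qed.

Lemma mu_itv (x y : bool) a b : a <= b ->
  mu [set` Interval (BSide x a) (BSide y b)] = (b - a)%:E.
Proof.
move=> ab; transitivity (lebesgue_measure
  ([set` Interval (BSide x a) (BSide y b)] : set (measurableTypeR R))) => //.
rewrite lebesgue_measure_itv/= lte_fin -EFinB.
by case: ltgtP ab => // ->; rewrite subrr.
Qed.

Lemma mu_cut A B : lebesgue_measurable A ->
  mu B = (mu (B `&` A) + mu (B `\` A))%E.
Proof. by move=> /lebesgue_measurableP mA; rewrite [LHS](mA B). Qed.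

Lemma mu_le A B : A `<=` B -> (mu A <= mu B)%E.
Proof. by move=> AB; apply: le_outer_measure. Qed.

Lemma mu_leU A B : (mu (A `|` B) <= mu A + mu B)%E.
Proof. by apply: outer_measureU2. Qed.

Lemma mu_ge0 A : (0 <= mu A)%E.
Proof. by apply: outer_measure_ge0. Qed.

Lemma mu_set0 : mu set0 = 0%E.
Proof. by apply: outer_measure0. Qed.

Lemma mu_le_bigcup (F : (set R)^nat) :
  (mu (\bigcup_n F n) <= \sum_(0 <= n <oo) mu (F n))%E.
Proof. by apply: outer_measure_sigma_subadditive. Qed.

Lemma mu_le_bigsetU (F : (set R)^nat) (n : nat) :
  (mu (\big[setU/set0]_(i < n) F i) <= \sum_(i < n) mu (F i))%E.
Proof. by apply: outer_measure_subadditive. Qed.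

End lebesgue_outer_measure.

(** * Periodic functions and periodic sets *)

Lemma periodicz {R : realType} {T : Type} (f : R -> T) (P : R) :
  (forall u, f (u + P) = f u) -> forall u (k : int), f (u + k%:~R * P) = f u.
Proof.
move=> fP; have fn (n : nat) v : f (v + n%:R * P) = f v.
  elim: n v => [|n IH] v; first by rewrite mul0r addr0.
  by rewrite -natr1 mulrDl mul1r addrA fP IH.
move=> u [n|n]; first exact: fn.
by rewrite NegzE mulrNz -[LHS](fn n.+1) mulNr subrK.
Qed.

Section periodic_sets.
Context {R : realType}.
Implicit Types (A B E : set R) (a b s L : R).

Local Notation mu := ((@wlength R idfun)^*)%mu.

Lemma mu_itv_split a b c E : a <= b <= c ->
  mu (E `&` `[a, c[) = (mu (E `&` `[a, b[) + mu (E `&` `[b, c[))%E.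
Proof.
move=> /andP[ab bc]; rewrite (mu_cut _ _ (lebesgue_measurable_itv `[a, b[)).
congr (mu _ + mu _)%E; apply/seteqP; split=> u /=; rewrite !in_itv/=.
- by move=> [[]].
- by move=> [Eu /andP[au ub]]; rewrite au ub (lt_le_trans ub).
- by move=> [[Eu /andP[au uc]]]; rewrite au/= uc => /negP; rewrite -leNgt => ->.
- move=> [Eu /andP[bu uc]]; rewrite (le_trans ab bu) uc; split => //.
  by apply/negP; rewrite /= -leNgt.
Qed.

Section periodic_set.
Variables (L : R) (E : set R).
Hypotheses (L0 : 0 < L) (perE : shifted L E = E).

Lemma periodic_set_int u (k : int) : E (u + k%:~R * L) = E u.
Proof. by apply: periodicz => v; rewrite -[in RHS]perE. Qed.

Lemma shifted_periodic s : shifted L (shifted s E) = shifted s E.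
Proof. by rewrite shiftedD addrC -shiftedD perE. Qed.

Lemma periodic_set_bigcup :
  E = \bigcup_(k : int) shifted (k%:~R * L) (E `&` `[0, L[).
Proof.
apply/seteqP; split=> u /=; last first.
  by move=> [k _ [/=]]; rewrite /shifted/= periodic_set_int.
(* Subtracting floor(u / L) periods brings [u] into [[0, L[]. *)
move=> Eu; exists (- Num.floor (u / L)) => //.
rewrite /shifted/= periodic_set_int in_itv/=; split=> //.
rewrite intrN mulNr subr_ge0 -ler_pdivlMr// floor_le/=.
have := lt_succ_floor (u / L).
by rewrite ltr_pdivrMr// intrD mulrDl mul1r -ltrBlDl.
Qed.

Lemma periodic_set_measurable :
  lebesgue_measurable (E `&` `[0, L[) -> lebesgue_measurable E.
Proof.
move=> mE; rewrite periodic_set_bigcup.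
apply: countable_bigcupT_measurable => // k.
exact: lebesgue_measurable_shifted.
Qed.

Lemma periodic_set_null : mu (E `&` `[0, L[) = 0%E -> mu E = 0%E.
Proof.
move=> E0; apply/eqP; rewrite eq_le mu_ge0 andbT.
(* The integer translates are listed along the naturals; an [n] that codes no integer repeats the
   translate by 0, which is null as well. *)
pose F n :=
  shifted ((odflt 0 (unpickle n : option int))%:~R * L) (E `&` `[0, L[).
have EF : E `<=` \bigcup_n F n.
  rewrite {1}periodic_set_bigcup => u [k _ Eku].
  by exists (pickle k) => //; rewrite /F pickleK.
apply: (le_trans (mu_le _ _ EF)).
apply: (le_trans (mu_le_bigcup F)).
by rewrite eseries0// => n _ _; rewrite /F mu_shifted.
Qed.

(** The window [[0, L[] becomes [[s, s + L[], whose end [[L, s + L[] is carried by one period onto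
    the missing piece [[0, s[]. *)
Lemma mu_shifted_periodic s : 0 <= s <= L ->
  mu (shifted s E `&` `[0, L[) = mu (E `&` `[0, L[).
Proof.
move=> /andP[s0 sL].
have -> : shifted s E `&` `[0, L[ = shifted s (E `&` `[s, s + L[).
  by apply/seteqP; split=> u /=;
    rewrite /shifted/= !in_itv/= lerDr (addrC s L) ltrD2r.
have sLL : s <= L <= s + L by rewrite sL lerDr.
have sL0 : 0 <= s <= L by rewrite s0.
rewrite mu_shifted (mu_itv_split _ _ _ _ sLL) addeC (mu_itv_split _ _ _ _ sL0).
congr (_ + _)%E; rewrite -(mu_shifted L (E `&` `[L, s + L[)).
have EL u : E (u + L) = E u by rewrite -[in RHS]perE.
by congr (mu _); apply/seteqP; split=> u /=;
  rewrite /shifted/= EL !in_itv/= lerDr ltrD2r.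
Qed.

End periodic_set.
End periodic_sets.

(** * Upper bounds for a periodic set disjoint from its translate *)

Section avoiding_periodic_set.
Context {R : realType}.
Variables (L theta : R) (E : set R).
Hypotheses (L0 : 0 < L) (perE : shifted L E = E) (mE : lebesgue_measurable E).
Hypotheses (theta0L : 0 <= theta <= L) (avoidE : E `&` shifted theta E = set0).

Local Notation mu := ((@wlength R idfun)^*)%mu.
Let G := ~` (E `|` shifted theta E).

(** [E], its translate and the gap [G] partition the line; two successive Caratheodory cuts of [J]
    give the sum. *)
Lemma mu_avoiding_split (J : set R) :
  mu J = (mu (E `&` J) + mu (shifted theta E `&` J) + mu (G `&` J))%E.
Proof.
have mE' := lebesgue_measurable_shifted theta E mE.
rewrite (mu_cut E J mE) (mu_cut (shifted theta E) (J `\` E) mE') addeA.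
congr (mu _ + mu _ + mu _)%E; first by rewrite setIC.
- apply/seteqP; split=> u /=; first by move=> [[]].
  move=> [Etu Ju]; do 2?split=> //; move=> Eu.
  by have : (E `&` shifted theta E) u by []; rewrite avoidE.
- by rewrite setDDl setDE setIC.
Qed.

Lemma mu_period_fin (A : set R) :
  exists2 r, mu (A `&` `[0, L[) = r%:E & 0 <= r.
Proof.
have : (mu (A `&` `[0%R, L[) <= L%:E)%E.
  by rewrite -[L in leRHS]subr0 -(mu_itv true true 0 L (ltW L0)) mu_le.
have := mu_ge0 (A `&` `[0, L[).
by case: (mu _) => [r|//|//]; exists r.
Qed.

Lemma mu_avoiding_gap m g : mu (E `&` `[0, L[) = m%:E ->
  mu (G `&` `[0, L[) = g%:E -> m + m + g = L.
Proof.
move=> Em Gg; have := mu_avoiding_split `[0, L[.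
rewrite (mu_itv true true 0 L (ltW L0)) (mu_shifted_periodic L)// Em Gg.
rewrite -!EFinD subr0.
by move=> [->].
Qed.

Lemma mu_avoiding_le_half : (mu (E `&` `[0%R, L[) <= (L / 2)%:E)%E.
Proof.
have [m Em m0] := mu_period_fin E; have [g Gg g0] := mu_period_fin G.
have mg := mu_avoiding_gap m g Em Gg; rewrite Em lee_fin; lra.
Qed.

(** The shift [n%:R * theta] may exceed [L], whereas [mu_shifted_periodic] handles shifts in [0, L];
    hence the induction by steps of [theta]. *)
Lemma shifted_gap_period n :
  mu (shifted (n%:R * theta) G `&` `[0, L[) = mu (G `&` `[0, L[).
Proof.
have perG : shifted L G = G.
  by rewrite shiftedC shiftedU (shifted_periodic L)// perE.
elim: n => [|n IH]; first by rewrite mul0r shifted0.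
rewrite -natr1 mulrDl mul1r addrC -shiftedD (mu_shifted_periodic L)//.
exact: shifted_periodic.
Qed.

Lemma odd_orbit_meets_gap (q : nat) (k : int) u :
  odd q -> q%:R * theta = k%:~R * L ->
  exists2 j, (j < q)%N & G (u + j%:R * theta).
Proof.
move=> oddq qtheta; apply: contrapT => noG.
(* Off the gap, each step by [theta] flips membership in [E]. After an odd number [q] of steps it is
   negated, yet the point is back at [u] modulo [L]. *)
have alt j : (j <= q)%N -> `[< E (u + j%:R * theta) >] = `[< E u >] (+) odd j.
  elim: j => [|j IH] jq; first by rewrite mul0r addr0 addbF.
  have nG : ~ G (u + j%:R * theta) by move=> Gj; apply: noG; exists j.
  rewrite oddS addbN -IH ?(ltnW jq)// -natr1 mulrDl mul1r addrA.
  case: (asboolP (E (u + j%:R * theta))) => [Ej|nEj] /=.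
    apply/asboolPn => Ej1.
    have : (E `&` shifted theta E) (u + j%:R * theta) by [].
    by rewrite avoidE.
  by apply/asboolP; apply: contrapT => nEj1; apply: nG => -[].
have := alt q (leqnn q); rewrite qtheta (periodic_set_int L)// oddq.
by case: asbool.
Qed.

Lemma mu_avoiding_le_odd (q : nat) (k : int) :
  odd q -> q%:R * theta = k%:~R * L ->
  (mu (E `&` `[0%R, L[) <= ((q%:R - 1) / (2 * q%:R) * L)%:E)%E.
Proof.
move=> oddq qtheta.
have [m Em m0] := mu_period_fin E; have [g Gg g0] := mu_period_fin G.
have mg := mu_avoiding_gap m g Em Gg.
have q0 : 0 < q%:R :> R by rewrite ltr0n odd_gt0.
(* As 2 m + g = L, the bound on m amounts to g >= L / q, which holds because [q] translates of the
   gap cover a period. *)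
suff Lqg : L <= q%:R * g.
  rewrite Em lee_fin mulrAC ler_pdivlMr ?mulr_gt0//.
  have -> : m = (L - g) / 2 by lra.
  have -> : (L - g) / 2 * (2 * q%:R) = q%:R * L - q%:R * g by field.
  lra.
pose F (i : nat) := shifted (i%:R * theta) G `&` `[0, L[.
have cover : `[0, L[ `<=` \big[setU/set0]_(i < q) F i.
  move=> u uL; have [j jq Gj] := odd_orbit_meets_gap q k u oddq qtheta.
  by rewrite -(bigcup_mkord q F); exists j.
rewrite -lee_fin -[L in leLHS]subr0 -(mu_itv true true 0 L (ltW L0)).
apply: (le_trans (mu_le _ _ cover)); apply: (le_trans (mu_le_bigsetU F q)).
under eq_bigr do rewrite shifted_gap_period Gg.
by rewrite sumEFin lee_fin sumr_const card_ord mulr_natl.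
Qed.

End avoiding_periodic_set.

(** * Density of the multiples of an irrational number modulo 1 *)

Section irrational_rotation.
Context {R : realType}.
Implicit Types (t s e : R).

Lemma irrational_neq_frac t (a b : int) : irrational t ->
  a != 0 -> a%:~R * t + b%:~R != 0.
Proof.
move=> irr a0; apply/negP => /eqP atb; apply: irr => /=.
exists (- (b%:~R / a%:~R)) => //.
have aR0 : a%:~R != 0 :> R by rewrite intr_eq0.
rewrite rmorphN fmorph_div/= !ratr_int; apply: (mulfI aR0).
by rewrite mulrN mulrCA divff// mulr1; apply/esym/eqP; rewrite -addr_eq0 atb.
Qed.

(* Pigeonhole on the fractional parts of the multiples of t. *)
Lemma irrational_small_multiple t e : irrational t -> 0 < e ->
  exists a b : int, 0 < a%:~R * t + b%:~R < e.
Proof.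
move=> irr e0.
have [K Ke] : exists K : nat, e^-1 < K.+1%:R.
  by exists (Num.truncn e^-1); apply: truncnS_gt.
pose r (i : nat) := i%:R * t - (Num.floor (i%:R * t))%:~R.
have r01 i : 0 <= r i < 1.
  rewrite subr_ge0 floor_le/= ltrBlDl.
  by have := lt_succ_floor (i%:R * t); rewrite intrD.
have rK i : (Num.truncn (r i * K.+1%:R) < K.+1)%N.
  have /andP[r0 r1] := r01 i.
  rewrite truncn_lt_nat ?mulr_ge0//.
  by rewrite -[ltRHS]mul1r ltr_pM2r.
(* K + 2 fractional parts fall into K + 1 boxes of width 1 / (K + 1) < e. *)
pose c (i : 'I_K.+2) : 'I_K.+1 := Ordinal (rK i).
have /injectivePn[i [j ij cij]] : ~~ injectiveb c.
  by apply/negP => /injectiveP /leq_card; rewrite !card_ord ltnn.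
have close : `|r i - r j| < e.
  have tr k : (Num.truncn (r k * K.+1%:R))%:R <= r k * K.+1%:R
      < (Num.truncn (r k * K.+1%:R))%:R + 1.
    have /andP[r0 _] := r01 k.
    by rewrite natr1 truncn_itv// mulr_ge0.
  have := tr i; have := tr j; move: cij => /(congr1 val)/= ->.
  move=> /andP[? ?] /andP[? ?].
  have : `|r i - r j| * K.+1%:R < 1.
    rewrite -[X in _ * X]ger0_norm// -normrM mulrBl ltr_norml; lra.
  rewrite -ltr_pdivlMr// div1r => /lt_trans; apply.
  by rewrite invf_plt// posrE.
pose a := i%:Z - j%:Z.
pose b := Num.floor (j%:R * t) - Num.floor (i%:R * t).
have rab : r i - r j = a%:~R * t + b%:~R.
  by rewrite /r /a /b !intrD !intrN; ring.
have a0 : a != 0 by rewrite subr_eq0; apply: contra ij => /eqP[] /val_inj ->.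
(* The difference of two parts in one box is nonzero by irrationality; if it is negative, both
   coefficients change sign. *)
have := irrational_neq_frac t a b irr a0; rewrite -rab neq_lt => /orP[lt0|gt0].
  exists (- a), (- b); rewrite !intrN mulNr -opprD -rab.
  by rewrite -(ltr0_norm lt0) close normr_gt0 lt_eqF.
by exists a, b; rewrite -rab gt0/= -(gtr0_norm gt0).
Qed.

(** The multiples of a combination d in ]0, e[ form a grid of mesh less than [e]; the one just below
    [s] is chosen. *)
Lemma irrational_dense t s e : irrational t -> 0 < e ->
  exists a b : int, `|a%:~R * t + b%:~R - s| < e.
Proof.
move=> irr e0.
have [a [b /andP[d0 de]]] := irrational_small_multiple t e irr e0.
set d := a%:~R * t + b%:~R in d0 de.
pose k := Num.floor (s / d).
exists (k * a), (k * b).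
have -> : (k * a)%:~R * t + (k * b)%:~R - s = k%:~R * d - s.
  by rewrite /d !intrM; ring.
have k1 : k%:~R * d <= s by rewrite -ler_pdivlMr// floor_le.
have k2 : s < (k%:~R + 1) * d.
  by rewrite -ltr_pdivrMr//; have := lt_succ_floor (s / d); rewrite intrD.
rewrite mulrDl mul1r in k2.
by rewrite ltr_norml; apply/andP; split; lra.
Qed.

End irrational_rotation.

(** * Density 1/2 is impossible for an irrational rotation *)

Section irrational_shift.
Context {R : realType}.
Variables (L theta : R) (E : set R).
Hypotheses (L0 : 0 < L) (perE : shifted L E = E) (mE : lebesgue_measurable E).
Hypotheses (theta0L : 0 <= theta <= L) (avoidE : E `&` shifted theta E = set0).
Hypothesis irr : irrational (theta / L).

Local Notation mu := ((@wlength R idfun)^*)%mu.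
Let G := ~` (E `|` shifted theta E).

Hypothesis halfE : mu (E `&` `[0, L[) = (L / 2)%:E.

Let mu_gap0 : mu G = 0%E.
Proof.
apply: (periodic_set_null L) => //.
  by rewrite shiftedC shiftedU (shifted_periodic L)// perE.
have [g Gg g0] := mu_period_fin L L0 G.
have := mu_avoiding_gap L theta E L0 perE mE theta0L avoidE _ _ halfE Gg.
(* Here L / 2 + L / 2 + g = L, so the gap is null over a period. *)
by move=> Lg; rewrite Gg; congr EFin; lra.
Qed.

Section window.
Variable l : R.
Hypothesis l0 : 0 <= l.

Let mu_itvl s : mu `]s, s + l] = l%:E.
Proof.
have sl : s <= s + l by rewrite lerDl.
by rewrite (mu_itv false false s _ sl) addrAC subrr add0r.
Qed.

Let h s := fine (mu (E `&` `]s, s + l])).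

Let hE s : mu (E `&` `]s, s + l]) = (h s)%:E.
Proof.
have : (mu (E `&` `]s, (s + l)%R]) <= l%:E)%E.
  by rewrite -(mu_itvl s) mu_le.
have := mu_ge0 (E `&` `]s, s + l]).
by rewrite /h; case: (mu _) => [r|//|//].
Qed.

Let h_shift s c : shifted c E = E -> h (s + c) = h s.
Proof.
move=> cE; rewrite /h -(mu_shifted c); congr (fine (mu _)).
by rewrite shiftedI cE shifted_itvoc addrK addrAC addrK.
Qed.

(** Since the gap is null, [E] and its translate share the window, and the translate's part of it is
    a window of [E] at [s + theta]. *)
Let h_theta s : h s + h (s + theta) = l.
Proof.
have := mu_avoiding_split theta E mE avoidE `]s, s + l].
rewrite mu_itvl hE -/G.
have -> : mu (shifted theta E `&` `]s, s + l]) = (h (s + theta))%:E.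
  rewrite -hE -[RHS](mu_shifted theta).
  by rewrite shiftedI shifted_itvoc addrK addrAC addrK.
have -> : mu (G `&` `]s, s + l]) = 0%E.
  by apply/eqP; rewrite eq_le mu_ge0 andbT -mu_gap0 mu_le.
by rewrite adde0 -EFinD => -[].
Qed.

(** The window at [s] lies in the window at [s'] together with one interval of length |s - s'|. *)
Let h_lipschitz s s' : h s <= h s' + `|s - s'|.
Proof.
rewrite -lee_fin EFinD -!hE.
have [ss'|s's] := leP s s'.
  have sub : E `&` `]s, s + l] `<=` (E `&` `]s', s' + l]) `|` `]s, s'].
    move=> u /= [Eu]; rewrite !in_itv/= => /andP[su usl].
    have [us'|s'u] := leP u s'; first by right; rewrite su.
    by left; split=> //=; rewrite (le_trans usl)// lerD2r.
  apply: (le_trans (mu_le _ _ sub)); apply: (le_trans (mu_leU _ _)).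
  by rewrite (mu_itv false false _ _ ss') distrC ger0_norm ?subr_ge0.
have sub : E `&` `]s, s + l] `<=` (E `&` `]s', s' + l]) `|` `]s' + l, s + l].
  move=> u /= [Eu]; rewrite !in_itv/= => /andP[su usl].
  have [us'|s'u] := leP u (s' + l); last by right; rewrite usl.
  by left; split=> //=; rewrite (lt_trans s's).
apply: (le_trans (mu_le _ _ sub)); apply: (le_trans (mu_leU _ _)).
have s'l : s' + l <= s + l by rewrite lerD2r ltW.
have -> : `|s - s'| = s + l - (s' + l).
  by rewrite gtr0_norm ?subr_gt0// opprD addrACA subrr addr0.
by rewrite (mu_itv false false _ _ s'l).
Qed.

Lemma mu_window s : (mu (E `&` `]s, (s + l)%R]) <= (l / 2)%:E)%E.
Proof.
have h2 v : h (v + 2 * theta) = h v.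
  have -> : v + 2 * theta = v + theta + theta by ring.
  by have := h_theta v; have := h_theta (v + theta); lra.
have hL v : h (v + L) = h v by exact: h_shift.
(* With h(s) + h(s + theta) = l, this one-sided comparison already gives h(s) <= l / 2. *)
suff hle e : 0 < e -> h s <= h (s + theta) + e.
  have /ler_addgt0Pr := hle; have := h_theta s.
  by rewrite hE lee_fin; lra.
move=> e0; have e2L : 0 < e / 2 / L by rewrite !divr_gt0.
(* Multiplied by 2 L, the approximation says that a (2 theta) + (2 b) L, which leaves h unchanged,
   is within [e] of [theta]. *)
have [a [b ab]] := irrational_dense (theta / L) (theta / (2 * L)) _ irr e2L.
rewrite -(periodicz _ _ h2 s a) -(periodicz _ _ hL _ (2 * b)).
apply: (le_trans (h_lipschitz _ (s + theta))); rewrite lerD2l.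
have -> : s + a%:~R * (2 * theta) + (2 * b)%:~R * L - (s + theta) =
    (a%:~R * (theta / L) + b%:~R - theta / (2 * L)) * (2 * L).
  by rewrite intrM; field; rewrite lt0r_neq0.
rewrite normrM (gtr0_norm (_ : 0 < 2 * L)) ?mulr_gt0//.
rewrite -ler_pdivlMr ?mulr_gt0// (le_trans (ltW ab))//.
by rewrite le_eqVlt; apply/orP; left; apply/eqP; field; rewrite lt0r_neq0.
Qed.

End window.

(** Each interval of a cover of [E] over a period meets [E] in at most half its length, so twice the
    measure m is at most the total length of the cover. The infimum over covers gives 2 m <= m,
    although m = L / 2 > 0. *)
Lemma half_avoiding_absurd : False.
Proof.
suff : (mu (E `&` `[0%R, L[) + mu (E `&` `[0%R, L[) <= mu (E `&` `[0%R, L[))%E.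
  by rewrite halfE -EFinD lee_fin => half_le; move: L0; lra.
apply: le_ereal_inf_tmp => _ [F [mF EF] <-].
have FE k : (mu (E `&` F k) + mu (E `&` F k) <= wlength idfun (F k))%E.
  have [[a b] _ <-] := mF k; rewrite /= wlength_itv/= lte_fin.
  case: ltP => [ab|ba]; last first.
    by rewrite set_itv_ge ?setI0 ?mu_set0 ?adde0// bnd_simp -leNgt.
  have ba0 : 0 <= b - a by rewrite subr_ge0 ltW.
  have := mu_window (b - a) ba0 a; rewrite addrC subrK => hab.
  by rewrite -EFinB (splitr (b - a)) EFinD leeD.
have le1 : (mu (E `&` `[0%R, L[) <= \sum_(0 <= k <oo) mu (E `&` F k))%E.
  apply: le_trans (mu_le_bigcup _); apply: mu_le => u Au.
  have [k _ Fku] := EF _ Au; exists k => //; split => //; exact: Au.1.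
apply: (le_trans (leeD le1 le1)); rewrite -nneseriesD.
- by apply: lee_nneseries => k _ //; rewrite adde_ge0// mu_ge0.
- by move=> *; exact: mu_ge0.
- by move=> *; exact: mu_ge0.
Qed.

End irrational_shift.

(** * Points of the circle and their angles *)

Section circle_angles.
Context {R : realType}.
Implicit Types (u v a b x theta : R) (I : set 'rV[R]_2).

Local Notation mu := ((@wlength R idfun)^*)%mu.

Lemma cosDz u (k : int) : cos (u + k%:~R * (2 * pi)) = cos u.
Proof. by apply: periodicz => v; rewrite mulr_natl cosD2pi. Qed.

Lemma sinDz u (k : int) : sin (u + k%:~R * (2 * pi)) = sin u.
Proof. by apply: periodicz => v; rewrite mulr_natl sinD2pi. Qed.

Lemma cos_eq u v : 0 <= v <= pi -> cos u = cos v ->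
  exists k : int, u = v + k%:~R * (2 * pi) \/ u = - v + k%:~R * (2 * pi).
Proof.
move=> v0pi cuv; have pi0 : 0 < 2 * pi :> R by rewrite mulr_gt0// pi_gt0.
(* Adding pi before taking the floor places w in [-pi, pi]; the sign of w then selects the case, by
   injectivity of cos on [0, pi]. *)
pose k := Num.floor ((u + pi) / (2 * pi)); pose w := u - k%:~R * (2 * pi).
have uw : u = w + k%:~R * (2 * pi) by rewrite /w subrK.
have wN : - pi <= w.
  have : k%:~R * (2 * pi) <= u + pi by rewrite -ler_pdivlMr// floor_le.
  by rewrite /w; lra.
have wpi : w <= pi.
  have : u + pi < (k%:~R + 1) * (2 * pi).
    rewrite -ltr_pdivrMr//.
    by have := lt_succ_floor ((u + pi) / (2 * pi)); rewrite intrD.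
  by rewrite /w; lra.
exists k; move: cuv; rewrite {1}uw cosDz => cwv.
have [w0|w0] := leP 0 w.
  left; rewrite {1}uw; congr (_ + _); apply: cos_inj => //.
  by rewrite in_itv/= w0.
right; rewrite {1}uw; congr (_ + _); apply: oppr_inj; rewrite opprK.
apply: cos_inj; rewrite ?cosN//.
by rewrite in_itv/= oppr_ge0 ltW//= lerNl.
Qed.

Lemma inner_circle_point a b :
  inner (circle_point a) (circle_point b) = cos (a - b).
Proof.
by rewrite /inner !big_ord_recl big_ord0 !mxE/= addr0 cosB.
Qed.

Lemma circle_point_unit a : unit_circle R (circle_point a).
Proof. by rewrite /unit_circle/= inner_circle_point subrr cos0. Qed.

Lemma circle_pointDz u (k : int) :
  circle_point (u + k%:~R * (2 * pi)) = circle_point u.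
Proof. by apply/rowP => i; rewrite !mxE cosDz sinDz. Qed.

Lemma circle_point_eq a b : circle_point a = circle_point b ->
  exists k : int, a = b + k%:~R * (2 * pi).
Proof.
move=> ab; have : cos (a - b) = cos 0.
  by rewrite -inner_circle_point ab inner_circle_point subrr.
case/cos_eq; first by rewrite lexx pi_ge0.
move=> k; rewrite oppr0 add0r => abk; exists k.
by case: abk => <-; rewrite addrC subrK.
Qed.

Lemma circle_measureE I :
  circle_measure I =
  ((2 * pi)^-1%:E * mu ((@circle_point R @^-1` I) `&` `[0%R, (2 * pi)%R[))%E.
Proof. by rewrite /circle_measure /circle_angles setIC. Qed.

Section preimage.
Variables (x : R) (I : set 'rV[R]_2).
Hypotheses (hx : -1 <= x <= 1) (mI : circle_measurable I).
Hypothesis avI : avoiding [set x] I.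

Let E := @circle_point R @^-1` I.

Lemma shifted_preimage_circle : shifted (2 * pi) E = E.
Proof.
by apply/seteqP; split=> u; rewrite /shifted/E/= -(circle_pointDz u 1) mul1r.
Qed.

Lemma preimage_circle_measurable : lebesgue_measurable E.
Proof.
apply: (periodic_set_measurable (2 * pi)).
- by rewrite mulr_gt0// pi_gt0.
- exact: shifted_preimage_circle.
- by rewrite setIC; exact: mI.2.
Qed.

Lemma preimage_circle_avoiding : E `&` shifted (acos x) E = set0.
Proof.
rewrite -subset0 => u [/= Eu Eux]; apply: (avI.2 _ _ Eux Eu).
by rewrite /= inner_circle_point addrAC subrr add0r acosK// in_itv.
Qed.

End preimage.

Lemma acos_0_2pi x : -1 <= x <= 1 -> 0 <= acos x <= 2 * pi.
Proof.
by move=> hx; rewrite acos_ge0//=; have := acos_lepi hx; have := pi_ge0 R; lra.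
Qed.

(** * Comb sets and the avoiding sets that they give *)

Section comb.
Variables (P c : R).
Hypotheses (P0 : 0 < P) (c01 : 0 <= c <= 1).

(** For c <= 1 the integer k is the floor of u / P, so the condition bounds the fractional part of u
    / P by c. With P = 2 pi / N the comb has N teeth on the circle. *)
Definition comb : set R :=
  [set u | exists k : int, k%:~R <= u / P < k%:~R + c].

Lemma shifted_comb : shifted P comb = comb.
Proof.
have Pn0 : P != 0 by rewrite gt_eqF.
apply/seteqP; split=> u [k]; rewrite ?mulrDl ?divff// => uk.
  by exists (k - 1); rewrite intrD intrN; lra.
by exists (k + 1); rewrite mulrDl divff// intrD; lra.
Qed.

Lemma combI : comb `&` `[0, P[ = `[0, (c * P)[%classic.
Proof.
move: c01 => /andP[c0 c1]; apply/seteqP; split=> u /=; rewrite !in_itv/=.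
  move=> [[k /andP[ku uk]] /andP[u0 uP]]; rewrite u0/= -ltr_pdivrMr//.
  have u1 : u / P < 1 by rewrite ltr_pdivrMr// mul1r.
  have k0 : (k < 1)%R by rewrite -(ltr_int R); apply: le_lt_trans u1.
  have : k%:~R <= 0 :> R by rewrite -[0]/(0%:~R) ler_int -ltzD1.
  lra.
move=> /andP[u0 uc]; split.
  by exists 0; rewrite mulr0z add0r ltr_pdivrMr// uc andbT divr_ge0// ltW.
by rewrite u0 (lt_le_trans uc)// -[leRHS]mul1r ler_pM2r.
Qed.

Lemma comb_measurable : lebesgue_measurable comb.
Proof.
apply: (periodic_set_measurable P) => //; first exact: shifted_comb.
by rewrite combI; exact: lebesgue_measurable_itv.
Qed.

Lemma mu_comb (n : nat) : mu (comb `&` `[0, n%:R * P[) = (n%:R * (c * P))%:E.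
Proof.
move: c01 => /andP[c0 c1].
elim: n => [|n IH].
  by rewrite !mul0r set_itv_ge ?bnd_simp// setI0 mu_set0.
have nP : 0 <= n%:R * P <= n.+1%:R * P.
  by rewrite ler_pM2r// ler_nat leqnSn andbT mulr_ge0// ltW.
rewrite (mu_itv_split _ _ _ _ nP) IH.
(* The last tooth is moved back to [[0, P[], where [combI] measures it. *)
rewrite -(mu_shifted (n%:R * P) (_ `&` `[_, n.+1%:R * P[)).
rewrite shiftedI shifted_itvco subrr -natr1 mulrDl mul1r addrAC subrr add0r.
have -> : shifted (n%:R * P) comb = comb.
  apply/seteqP; split=> u; rewrite /shifted/=.
    by rewrite (periodic_set_int P _ shifted_comb u n).
  by rewrite (periodic_set_int P _ shifted_comb u n).
rewrite combI (mu_itv true true) ?mulr_ge0 ?(ltW P0)// subr0 -EFinD.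
by congr EFin; ring.
Qed.

End comb.

(** In units of P = 2 pi / N, angles of the comb differ, modulo 1, by less than c, whereas the
    rotation by [acos x] moves by s, at distance at least c from every integer. *)
Lemma circle_witness x (N : nat) c s (z : int) : -1 <= x <= 1 ->
  (0 < N)%N -> 0 <= c -> c <= s <= 1 - c ->
  N%:R * (acos x / (2 * pi)) = s + z%:~R ->
  exists I : set 'rV[R]_2,
    [/\ circle_measurable I, avoiding [set x] I & circle_measure I = c%:E].
Proof.
move=> hx N0 c0 /andP[cs sc] Nt.
have pi0 : 0 < 2 * pi :> R by rewrite mulr_gt0// pi_gt0.
have pin0 : pi != 0 :> R by rewrite gt_eqF// pi_gt0.
have Nn0 : N%:R != 0 :> R by rewrite pnatr_eq0 -lt0n.
pose P : R := 2 * pi / N%:R.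
have P0 : 0 < P by rewrite divr_gt0 ?ltr0n.
have NP : N%:R * P = 2 * pi by rewrite /P mulrCA divff// mulr1.
have c01 : 0 <= c <= 1 by lra.
have preE : @circle_point R @^-1` (@circle_point R @` comb P c) = comb P c.
  apply/seteqP; split=> u /=; last by exists u.
  move=> [v Dv /circle_point_eq[k uv]].
  have /= := periodic_set_int P _ (shifted_comb P c P0) u (N%:Z * k).
  by rewrite intrM mulrAC NP (mulrC (2 * pi)) -uv => <-.
have gap a b (k : int) : comb P c a -> comb P c b ->
    a - b = acos x + k%:~R * (2 * pi) -> False.
  move=> [i ai] [j bj] ab.
  have : a / P - b / P = s + (z + N%:Z * k)%:~R.
    rewrite -mulrBl ab mulrDl intrD intrM addrA -Nt /P.
    by move: (@pi R) pin0 => p pn0; field; rewrite Nn0 pn0.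
  (* The integer m differs from s by less than c, hence would lie strictly between 0 and 1. *)
  set m := i - j - (z + N%:Z * k) => abP.
  have mE : m%:~R = i%:~R - j%:~R - (z + N%:Z * k)%:~R :> R.
    by rewrite /m !rmorphB.
  have m0 : 0 < m by rewrite -(ltr_int R) mE; lra.
  have m1 : 1 <= m%:~R :> R by rewrite -[1]/(1%:~R) ler_int -gtz0_ge1.
  by rewrite mE in m1; lra.
exists (@circle_point R @` comb P c); split.
- split=> [_ [u _ <-]|]; first exact: circle_point_unit.
  rewrite /circle_angles preE; apply: measurableI.
    exact: lebesgue_measurable_itv.
  exact: comb_measurable.
- split=> [_ [u _ <-]|]; first exact: circle_point_unit.
  move=> _ _ [a Da <-] [b Db <-]; rewrite inner_circle_point /= => cx.
  have [] := @cos_eq (a - b) (acos x).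
  + by rewrite acos_ge0 ?acos_lepi.
  + by rewrite acosK// in_itv.
  + move=> k [abk|abk]; first exact: (gap a b k).
    (* The solution with -acos x is the previous case with the two points exchanged. *)
    by apply: (gap b a (- k)) => //; rewrite -opprB abk intrN; ring.
- rewrite circle_measureE preE -NP mu_comb//; rewrite NP.
  rewrite -EFinM; congr EFin; rewrite /P.
  by move: (@pi R) pin0 => p pn0; field; rewrite Nn0 pn0.
Qed.

End circle_angles.

(** * Transfer of the bounds to the circle *)

Section alpha2_bounds.
Context {R : realType}.
Variable x : R.
Hypothesis hx : -1 <= x <= 1.

Local Notation mu := ((@wlength R idfun)^*)%mu.

Let twopi_gt0 : 0 < 2 * pi :> R. Proof. by rewrite mulr_gt0// pi_gt0. Qed.

Lemma alpha2_le (c : R) :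
  (forall E : set R, shifted (2 * pi) E = E -> lebesgue_measurable E ->
     E `&` shifted (acos x) E = set0 ->
     (mu (E `&` `[0%R, (2 * pi)%R[) <= (c * (2 * pi))%:E)%E) ->
  (alpha2 [set x] <= c%:E)%E.
Proof.
move=> muE; apply: ge_ereal_sup => _ [I [mI avI] <-].
rewrite circle_measureE muleC lee_pdivrMr// -EFinM; apply: muE.
- exact: shifted_preimage_circle.
- exact: preimage_circle_measurable.
- exact: preimage_circle_avoiding.
Qed.

Lemma alpha2_le_half : (alpha2 [set x] <= (1 / 2)%:E)%E.
Proof.
apply: alpha2_le => E perE mE avE.
have -> : 1 / 2 * (2 * pi) = 2 * pi / 2 :> R by rewrite mulrC mul1r.
exact: mu_avoiding_le_half perE mE (acos_0_2pi x hx) avE.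
Qed.

Lemma alpha2_le_odd (p : int) (q : nat) : odd q ->
  acos x / (2 * pi) = p%:~R / q%:R ->
  (alpha2 [set x] <= ((q%:R - 1) / (2 * q%:R))%:E)%E.
Proof.
move=> oddq tpq; apply: alpha2_le => E perE mE avE.
have theta0L := acos_0_2pi x hx.
apply: (mu_avoiding_le_odd _ _ E twopi_gt0 perE mE theta0L avE q p) => //.
have q0 : q%:R != 0 :> R by rewrite pnatr_eq0 -lt0n odd_gt0.
have -> : acos x = p%:~R / q%:R * (2 * pi).
  by rewrite -tpq divfK// gt_eqF.
by rewrite mulrA (mulrC q%:R) divfK.
Qed.

Lemma le_alpha2 (I : set 'rV[R]_2) :
  circle_measurable I -> avoiding [set x] I ->
  (circle_measure I <= alpha2 [set x])%E.
Proof. by move=> mI avI; apply: ereal_sup_ubound; exists I. Qed.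

Lemma half_not_attained : irrational (acos x / (2 * pi)) ->
  ~ exists I : set 'rV[R]_2,
      [/\ circle_measurable I, avoiding [set x] I &
          circle_measure I = (1 / 2)%:E].
Proof.
move=> irr [I [mI avI]]; rewrite circle_measureE => I2.
apply: (half_avoiding_absurd (2 * pi) (acos x) (@circle_point R @^-1` I)) => //.
- exact: shifted_preimage_circle.
- exact: preimage_circle_measurable.
- exact: acos_0_2pi.
- exact: preimage_circle_avoiding.
- have [m Em _] := mu_period_fin _ twopi_gt0 (@circle_point R @^-1` I).
  move: I2; rewrite Em -EFinM => -[m2]; congr EFin.
  apply: (mulfI (invr_neq0 (lt0r_neq0 twopi_gt0))); rewrite m2.
  by rewrite mulrA mulVf ?lt0r_neq0.
Qed.

End alpha2_bounds.

(** * Choice of the number of teeth, and the conclusion *)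

Lemma coprime_multiple (p : int) (q r : nat) : (0 < q)%N -> coprime `|p| q ->
  exists2 N : nat, (0 < N)%N & exists z : int, N%:Z * p = r%:Z + z * q%:Z.
Proof.
move=> q0 /eqP cpq; have [u [v]] := Bezoutz p q.
rewrite /gcdz absz_nat cpq => uv.
have q0' : q%:Z != 0 by lia.
(* Bezout's u p + v q = 1 makes u r a solution modulo q; adding q to its remainder keeps N
   positive. *)
exists (`|(u * r%:Z %% q%:Z)%Z| + q)%N; first by rewrite addn_gt0 q0 orbT.
exists (p - (u * r%:Z %/ q%:Z)%Z * p - v * r%:Z).
rewrite PoszD gez0_abs ?modz_ge0// /modz.
have rE : r%:Z = (u * p + v * q%:Z) * r%:Z by rewrite uv mul1r.
by rewrite [X in _ = X + _]rE; ring.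
Qed.

(** Some N makes N p congruent to floor(q / 2) modulo q. Then c = s = floor(q / 2) / q serves both
    parities, as 2 floor(q / 2) <= q. *)
Lemma rational_witness (R : realType) (x : R) (p : int) (q : nat) :
  -1 <= x <= 1 -> (0 < q)%N -> coprime `|p| q ->
  acos x / (2 * pi) = p%:~R / q%:R ->
  exists I : set 'rV[R]_2,
    [/\ circle_measurable I, avoiding [set x] I &
        circle_measure I = (q./2%:R / q%:R)%:E].
Proof.
move=> hx q0 cpq tpq.
have [N N0 [z Np]] := coprime_multiple p q q./2 q0 cpq.
have qR0 : 0 < q%:R :> R by rewrite ltr0n.
have q2 : 2 * q./2%:R <= q%:R :> R.
  by rewrite -natrM ler_nat mul2n -[leqRHS]odd_double_half leq_addl.
apply: (circle_witness x N _ (q./2%:R / q%:R) z hx N0).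
- by rewrite divr_ge0.
- by rewrite lexx/= lerBrDl -mulrDl ler_pdivrMr// mul1r; lra.
- rewrite tpq mulrA -[N%:R]/(N%:Z%:~R) -intrM Np intrD intrM mulrDl.
  by rewrite mulfK// gt_eqF.
Qed.

Lemma irrational_witness (R : realType) (x e : R) :
  -1 <= x <= 1 -> irrational (acos x / (2 * pi)) -> 0 < e <= 1 / 2 ->
  exists I : set 'rV[R]_2,
    [/\ circle_measurable I, avoiding [set x] I &
        circle_measure I = (1 / 2 - e)%:E].
Proof.
move=> hx irr /andP[e0 e1].
have [a [b]] := irrational_dense _ (1 / 2) e irr e0.
set t := acos x / (2 * pi); rewrite ltr_norml => /andP[ab1 ab2].
(* Otherwise the integer b would be at distance less than 1/2 from 1/2. *)
have a0 : a != 0.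
  apply/eqP => a0; rewrite a0 mul0r add0r in ab1 ab2.
  have : 0 < b by rewrite -(ltr_int R); lra.
  have : b < 1 by rewrite -(ltr_int R); lra.
  lia.
have [ap|an] := leP 0 a.
  apply: (circle_witness x `|a|%N _ (a%:~R * t + b%:~R) (- b) hx).
  - by rewrite absz_gt0.
  - by lra.
  - by apply/andP; split; lra.
  - by rewrite -/t natr_absz ger0_norm// intrN addrK.
(* For negative a the multiplier is -a, and s is reflected to 1 - s, equally close to 1/2. *)
apply: (circle_witness x `|a|%N _ (1 - (a%:~R * t + b%:~R)) (b - 1) hx).
- by rewrite absz_gt0.
- by lra.
- by apply/andP; split; lra.
- by rewrite -/t natr_absz ltr0_norm// intrN intrD intrN; ring.
Qed.

Theorem theorem2 (R : realType) (x : R) (hx : -1 <= x <= 1) :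
  let X := [set x] in
  let t := acos x / (2 * pi) in
  (forall (p : int) (q : nat), (1 <= q)%N -> coprime `|p|%N q ->
     t = p%:~R / q%:R ->
     alpha2 X = (if odd q then (q%:R - 1) / (2 * q%:R) else 1 / 2)%:E /\
     exists I : set 'rV[R]_2,
       [/\ circle_measurable I, avoiding X I & circle_measure I = alpha2 X]) /\
  (irrational t ->
     alpha2 X = (1 / 2)%:E /\
     ~ exists I : set 'rV[R]_2,
         [/\ circle_measurable I, avoiding X I &
             circle_measure I = (1 / 2)%:E]).
Proof.
move=> X t; split=> [p q q0 cpq tpq|irr].
  have [I [mI avI muI]] := rational_witness R x p q hx q0 cpq tpq.
  have qR0 : q%:R != 0 :> R by rewrite pnatr_eq0 -lt0n.
  have q2 : q%:R = (odd q)%:R + 2 * q./2%:R :> R.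
    by rewrite -natrM -natrD mul2n odd_double_half.
  (* Both values are floor(q / 2) / q, the density of the witness. *)
  have valE : (if odd q then (q%:R - 1) / (2 * q%:R) else 1 / 2) =
      q./2%:R / q%:R :> R.
    case: (odd q) q2 => /= q2.
      have -> : q./2%:R = (q%:R - 1) / 2 :> R by lra.
      by field.
    have -> : q./2%:R = q%:R / 2 :> R by lra.
    by field.
  have alphaE :
      alpha2 X = (if odd q then (q%:R - 1) / (2 * q%:R) else 1 / 2)%:E.
    apply/eqP; rewrite eq_le; apply/andP; split.
      case: ifP => oddq; first exact: alpha2_le_odd oddq tpq.
      exact: alpha2_le_half.
    by rewrite valE -muI; exact: le_alpha2.
  by split=> //; exists I; split=> //; rewrite alphaE muI valE.
split; last exact: half_not_attained.
apply/eqP; rewrite eq_le alpha2_le_half//=.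
apply/lee_addgt0Pr => e e0.
(* The minimum keeps the density 1/2 - e' nonnegative. *)
pose e' := Num.min e (1 / 2).
have e'0 : 0 < e' <= 1 / 2 by rewrite lt_min e0 ge_min lexx orbT /=; lra.
have [I [mI avI muI]] := irrational_witness R x e' hx irr e'0.
have : ((1 / 2 - e')%:E <= alpha2 X)%E by rewrite -muI; exact: le_alpha2.
rewrite EFinB leeBlDr// => /le_trans; apply; rewrite leeD2l// lee_fin.
by rewrite ge_min lexx.
Qed.
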